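(* Let $F\in\mathbb{F}$ and let the data $(A_{i,j,k})$ be such that the following three conditions hold. (1) There is at least one index pair $(i_1,j_1)$ with $0<A_{i_1,j_1,2}$. (2) There is a (directed) cycle in the directed graph whose nodes are the objects $1,\dots,n$ and which has a directed edge from $i$ to $j$ exactly when $0<A_{i,j,3}$. (3) For every partition of the objects $\{1,\dots,n\}$ into two non-empty subsets $S$ and $\overline{S}$, either there exist two (not necessarily different) index pairs $(i_2,j_2)$ and $(i_3,j_3)$ with $i_2,i_3\in S$, $j_2,j_3\in\overline{S}$ for which $0<A_{i_2,j_2,3}$ and $0<A_{i_3,j_3,1}$, or there exists an index pair $(i_4,j_4)$ with $i_4\in S$, $j_4\in\overline{S}$ for which $0<A_{i_4,j_4,2}$. Then, after fixing $m_1=0$, the likelihood function $$L(m_1,\dots,m_n,d)=\prod_{k=1}^{3}\prod_{i=1}^{n-1}\prod_{j=i+1}^{n} p_{i,j,k}(m_1,\dots,m_n,d)^{A_{i,j,k}}$$ attains its maximum value over $(m_2,\dots,m_n)\in\mathbb{R}^{n-1}$, $d>0$, and its argument (the maximizer) is unique.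
   Context: There are $n$ objects labelled $1,\dots,n$ compared in pairs with three options: ''worse'' ($k=1$), ''equal'' ($k=2$), ''better'' ($k=3$). The data are non-negative integers $A_{i,j,k}$ ($1\le i,j\le n$, $k=1,2,3$): $A_{i,j,k}$ is the number of judgments in which option $k$ was chosen when object $i$ is compared with object $j$ (so $A_{i,j,3}>0$ means that at least one opinion says $i$ is ''better'' than $j$). They satisfy $A_{i,i,k}=0$ and $A_{i,j,k}=A_{j,i,4-k}$. The parameters are $m_1,\dots,m_n\in\mathbb{R}$ and $d>0$. For a c.d.f. $F$ put $$p_{i,j,1}=F(-d-(m_i-m_j)),\quad p_{i,j,2}=F(d-(m_i-m_j))-F(-d-(m_i-m_j)),\quad p_{i,j,3}=1-F(d-(m_i-m_j)).$$ These are the probabilities of the options ''worse'', ''equal'', ''better'' when $i$ is compared with $j$. $\mathbb{F}$ denotes the set of c.d.f.'s $F$ such that $0<F(x)<1$ for all $x\in\mathbb{R}$, $F$ is three times continuously differentiable, its probability density function $f=F'$ is symmetric ($f(-x)=f(x)$), and $\log f$ is a strictly concave function on $\mathbb{R}$. A directed cycle may have length 2 (i.e. $0<A_{i,j,3}$ and $0<A_{j,i,3}$ for some $i\neq j$ is a cycle). *)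

(* Defs.v *)
From HB Require Import structures.
From mathcomp Require Import all_boot all_order all_algebra.
From mathcomp Require Import all_classical all_reals all_analysis.

Set Implicit Arguments.
Unset Strict Implicit.
Unset Printing Implicit Defensive.

Import Order.TTheory GRing.Theory Num.Theory.
Import numFieldNormedType.Exports.

Local Open Scope classical_set_scope.
Local Open Scope ring_scope.

Definition continuously_differentiable_n (R : realType) (n : nat) (f : R -> R) : Prop :=
  (forall k, (k < n)%N -> forall x, derivable f^`(k)%classic x 1) /\
  continuous f^`(n)%classic.

Definition strictly_concave (R : realType) (g : R -> R) : Prop :=
  forall x y t : R, x != y -> 0 < t < 1 ->
    t * g x + (1 - t) * g y < g (t * x + (1 - t) * y).

(* The class of admissible c.d.f.'s.  A c.d.f. is a [cumulativeBounded 0 1]: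
   nondecreasing, right-continuous, with limits 0 at -oo and 1 at +oo.
   Positivity of the density is implicit in "log f is a function on the whole
   line"; it has to be explicit because [ln] is total, with value 0 on
   nonpositive reals. *)
Record admissible_cdf (R : realType) (F : cumulativeBounded (0 : R) (1 : R)) : Prop := {
  cdf_in01 : forall x : R, 0 < F x < 1 ;
  cdf_C3 : continuously_differentiable_n 3 F ;
  pdf_sym : forall x : R, F^`()%classic (- x) = F^`()%classic x ;
  pdf_gt0 : forall x : R, 0 < F^`()%classic x ;
  log_pdf_strictly_concave : strictly_concave (fun x : R => ln (F^`()%classic x)) }.

(* The n objects are the elements of 'I_n (numbered from 0), and the options
   are k = 1 (worse), 2 (equal), 3 (better); the values of A outside
   1 <= k <= 3 are never used. *)
Record comparison_data (n : nat) (A : 'I_n -> 'I_n -> nat -> nat) : Prop := {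
  data_diag : forall i k, (1 <= k <= 3)%N -> A i i k = 0%N ;
  data_sym : forall i j k, (1 <= k <= 3)%N -> A i j k = A j i (4 - k)%N }.

Definition option_prob (R : realType) (F : R -> R) (n : nat)
    (m : 'rV[R]_n) (d : R) (i j : 'I_n) (k : nat) : R :=
  match k with
  | 1%N => F (- d - (m 0 i - m 0 j))
  | 2%N => F (d - (m 0 i - m 0 j)) - F (- d - (m 0 i - m 0 j))
  | 3%N => 1 - F (d - (m 0 i - m 0 j))
  | _ => 0
  end.

Definition likelihood (R : realType) (F : R -> R) (n : nat)
    (A : 'I_n -> 'I_n -> nat -> nat) (m : 'rV[R]_n) (d : R) : R :=
  \prod_(1 <= k < 4) \prod_(i < n) \prod_(j < n | (i < j)%N)
    option_prob F m d i j k ^+ A i j k.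

(* The first object has index 0 in 'I_n. *)
Definition parameter_set (R : realType) (n : nat) : set ('rV[R]_n * R) :=
  [set p : 'rV[R]_n * R | (forall i : 'I_n, nat_of_ord i = 0%N -> p.1 0 i = 0) /\ 0 < p.2].
Arguments parameter_set : clear implicits.

Definition is_argmax (R : realType) (T : Type) (D : set T) (f : T -> R) (x : T) : Prop :=
  D x /\ (forall y, D y -> f y <= f x).

Definition better_edge (n : nat) (A : 'I_n -> 'I_n -> nat -> nat) : rel 'I_n :=
  fun i j => (0 < A i j 3)%N.

(* A cycle is a nonempty sequence of pairwise distinct nodes; length 2 is
   allowed, and length 1 (a loop) is excluded by [data_diag]. *)
Definition has_directed_cycle (T : eqType) (e : rel T) : Prop :=
  exists c : seq T, c <> [::] /\ ucycle e c.

(* Main.v *)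
(* Existence.  Each factor of L is at most 1, so L >= l > 0 forces every
   probability with a positive exponent to be at least l.  An "equal" judgment
   then bounds d from below (f is maximal at 0); a cycle of "better" judgments
   has an edge i -> j with m_i <= m_j, which bounds d from above; and condition
   (3) links all the objects by comparisons that bound the gaps of m.  So L is
   maximized on a compact set.

   Uniqueness.  Each p_{i,j,k} is strictly midpoint log-concave in the arguments
   of F that it involves: for F (b) - F (a) this is a one-dimensional
   Prekopa-Leindler inequality, proved by transporting one interval onto the
   other with the quantile function.  Two maximizers must therefore have the
   same d, by (1), and the same m_i - m_j for every compared pair, and (3)
   connects the compared pairs. *)

Require Import Defs.
From HB Require Import structures.
From mathcomp Require Import all_boot all_order all_algebra.
From mathcomp Require Import all_classical all_reals all_analysis.
From mathcomp Require Import ring lra zify.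

Set Implicit Arguments.
Unset Strict Implicit.
Unset Printing Implicit Defensive.

Import Order.TTheory GRing.Theory Num.Theory.
Import numFieldNormedType.Exports.

Local Open Scope ring_scope.

(** * Strictly log-concave distribution functions *)

(** Log-concavity is recorded multiplicatively and only at midpoints, the form in which AM-GM meets
    it below. Surjectivity onto (0, 1) takes the place of the limits at infinity. *)
Record strictly_logconcave_cdf (R : realType) (F f : R -> R) : Prop := {
  slc_01 : forall x, 0 < F x < 1 ;
  slc_onto : forall p, 0 < p < 1 -> exists x, F x = p ;
  slc_derive : forall x, is_derive x (1 : R) F (f x) ;
  slc_gt0 : forall x, 0 < f x ;
  slc_mid : forall x y, x != y -> f x * f y < f (2^-1 * (x + y)) ^+ 2 }.

Lemma slc_continuous (R : realType) (F f : R -> R) :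
  strictly_logconcave_cdf F f -> continuous F.
Proof.
move=> HF x; apply/differentiable_continuous/derivable1_diffP.
by have [] := slc_derive HF x.
Qed.

Lemma slc_lt (R : realType) (F f : R -> R) :
  strictly_logconcave_cdf F f -> {mono F : x y / x < y}.
Proof.
move=> HF; apply: leW_mono; apply: le_mono => x y xy.
have [|c _] := MVT xy (fun z _ => slc_derive HF z).
  by apply: continuous_subspaceT; exact: slc_continuous HF.
by rewrite -subr_gt0 => ->; rewrite mulr_gt0 ?subr_gt0// (slc_gt0 HF).
Qed.

Lemma slc_inj (R : realType) (F f : R -> R) :
  strictly_logconcave_cdf F f -> injective F.
Proof.
move=> HF x y Fxy; apply/eqP; case: (ltgtP x y) => //;
  by rewrite -(slc_lt HF) Fxy ltxx.
Qed.

(** [Q] is the quantile function. On (0, 1) it inverts [F], so its derivative is the reciprocal of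
    the density; where [F] has no preimage, [xget] returns the default 0. *)
Lemma slc_quantile (R : realType) (F f : R -> R) :
    strictly_logconcave_cdf F f ->
  exists Q : R -> R, (forall x, Q (F x) = x) /\
    forall p, 0 < p < 1 -> F (Q p) = p /\ is_derive p (1 : R) Q (f (Q p))^-1.
Proof.
move=> HF; pose Q p := xget 0 [set x | F x = p]%classic.
have FK x : Q (F x) = x.
  by apply: (slc_inj HF); rewrite /Q; case: xgetP => [y _ |/(_ x)] //=; exact.
exists Q; split => // p /(slc_onto HF)[x <-]; rewrite FK; split => //.
apply: is_derive_inverse.
- by near=> z; exact: FK.
- by near=> z; exact: slc_continuous HF z.
- exact: slc_derive HF x.
- by rewrite gt_eqF ?(slc_gt0 HF).
Unshelve. all: by end_near. Qed.

Lemma slc_mid_le (R : realType) (F f : R -> R) (x y : R) :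
  strictly_logconcave_cdf F f -> f x * f y <= f (2^-1 * (x + y)) ^+ 2.
Proof.
move=> HF; have [<-|xy] := eqVneq x y; last exact/ltW/(slc_mid HF).
by rewrite [2^-1 * _](_ : _ = x) ?expr2//; field.
Qed.

(* Along the transport [u |-> (x u, y u)], [x] and [y] move at speeds [G / f x]
   and [G' / f y], so that by AM-GM and midpoint log-concavity of [f] the
   derivative of [F ((x + y) / 2)] is at least [sqrt (G * G')]. *)
Lemma transport_speed (R : realType) (F f : R -> R) (x y G G' : R) :
    strictly_logconcave_cdf F f -> 0 < G -> 0 < G' ->
  let s := f (2^-1 * (x + y)) * (2^-1 * (G / f x + G' / f y)) in
  Num.sqrt (G * G') <= s /\ (x != y -> Num.sqrt (G * G') < s).
Proof.
move=> HF G0 G'0 s.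
have [fx fy] := (slc_gt0 HF x, slc_gt0 HF y).
have fm := slc_gt0 HF (2^-1 * (x + y)).
have s0 : 0 < s by rewrite !mulr_gt0 ?addr_gt0 ?divr_gt0 ?invr_gt0.
have amgm : G * G' / (f x * f y) <= (2^-1 * (G / f x + G' / f y)) ^+ 2.
  rewrite -subr_ge0.
  rewrite [leRHS](_ : _ = (2^-1 * (G / f x - G' / f y)) ^+ 2) ?sqr_ge0//.
  by field; rewrite ?gt_eqF.
have GG : G * G' = f x * f y * (G * G' / (f x * f y)).
  by field; rewrite ?gt_eqF.
have P0 : 0 < G * G' / (f x * f y) by rewrite divr_gt0 ?mulr_gt0.
have E0 : 0 < f x * f y by rewrite mulr_gt0.
split=> [|xy].
- rewrite -(ger0_norm (ltW s0)) -sqrtr_sqr ler_wsqrtr// GG exprMn.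
  by rewrite ler_pM ?(slc_mid_le _ _ HF) ?(ltW E0) ?(ltW P0).
- rewrite -(ger0_norm (ltW s0)) -sqrtr_sqr ltr_sqrt ?exprn_gt0// GG exprMn.
  apply: (@lt_le_trans _ _ (f (2^-1 * (x + y)) ^+ 2 * (G * G' / (f x * f y)))).
    by rewrite ltr_pM2r// (slc_mid HF).
  by rewrite ler_pM2l ?exprn_gt0.
Qed.

(** Both intervals are parametrized by the fraction [u] of their mass, and [H u] is the value of [F]
    at the midpoint of the two quantiles. The speed of [H] is at least the geometric mean of the two
    masses, and [H] runs from the midpoint of the left ends to that of the right ends. *)
Lemma slc_interval_mid (R : realType) (F f : R -> R) (a b a' b' : R) :
    strictly_logconcave_cdf F f -> a < b -> a' < b' -> (a, b) != (a', b') ->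
  Num.sqrt ((F b - F a) * (F b' - F a')) <
    F (2^-1 * (b + b')) - F (2^-1 * (a + a')).
Proof.
move=> HF ab a'b' neq; have [Q [FK QK]] := slc_quantile HF.
have [Flt F01] := (slc_lt HF, slc_01 HF).
have G0 : 0 < F b - F a by rewrite subr_gt0 Flt.
have G'0 : 0 < F b' - F a' by rewrite subr_gt0 Flt.
pose p u := F a + u * (F b - F a); pose p' u := F a' + u * (F b' - F a').
have p01 c e u : c < e -> 0 <= u <= 1 -> 0 < F c + u * (F e - F c) < 1.
  move=> ce /andP[u0 u1]; have [/andP[? ?] /andP[? ?]] := (F01 c, F01 e).
  have : F c < F e by rewrite Flt.
  by move=> ?; apply/andP; split; nra.
have dp c e (u : R) :
    is_derive u (1 : R) (fun u => F c + u * (F e - F c)) (F e - F c).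
  by apply: is_derive_eq; rewrite /GRing.scale/=; ring.
pose H := F \o (fun u => 2^-1 * (Q (p u) + Q (p' u))).
pose dH u := f (2^-1 * (Q (p u) + Q (p' u))) *
  (2^-1 * ((F b - F a) / f (Q (p u)) + (F b' - F a') / f (Q (p' u)))).
have HdH (u : R) : 0 <= u <= 1 -> is_derive u (1 : R) H (dH u).
  move=> u01.
  have [_ d1] := QK _ (p01 _ _ _ ab u01).
  have [_ d2] := QK _ (p01 _ _ _ a'b' u01).
  have e1 := @is_derive1_comp _ Q p _ _ _ d1 (dp a b u).
  have e2 := @is_derive1_comp _ Q p' _ _ _ d2 (dp a' b' u).
  apply: is_derive1_comp; first exact: slc_derive HF _.
  by apply: is_derive_eq; congr (_ * (_ + _)); rewrite mulrC.
have Hmvt s t : 0 <= s -> s < t -> t <= 1 ->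
    exists2 c, s < c < t & H t - H s = dH c * (t - s).
  move=> s0 st t1; have [||c cst ->] := @MVT _ H dH _ _ st.
  - by move=> x; rewrite in_itv/= => /andP[? ?]; apply: HdH; lra.
  - apply: derivable_within_continuous => x; rewrite in_itv/= => /andP[? ?].
    have x01 : 0 <= x <= 1 by lra.
    by have [] := HdH _ x01.
  - by exists c => //; move: cst; rewrite in_itv.
have half : 0 < 2^-1 :> R by lra.
(* The mean value theorem is applied on each half separately: one point of coincidence of the two
   quantiles would not exclude equality, but two distinct ones force the intervals to coincide. *)
have [|||c1 /andP[c10 c1h] E1] := Hmvt 0 2^-1; [by []|by []|by lra|].
have [|||c2 /andP[c2h c21] E2] := Hmvt 2^-1 1; [by lra|by lra|by []|].
have H0 : H 0 = F (2^-1 * (a + a')).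
  by rewrite /H /p /p'/= !mul0r !addr0 !FK.
have H1 : H 1 = F (2^-1 * (b + b')).
  by rewrite /H /p /p'/= !mul1r !subrKC !FK.
rewrite -H0 -H1.
have [le1 lt1] := transport_speed (Q (p c1)) (Q (p' c1)) HF G0 G'0.
have [le2 lt2] := transport_speed (Q (p c2)) (Q (p' c2)) HF G0 G'0.
have [x1|/lt1 {}lt1] := eqVneq (Q (p c1)) (Q (p' c1)); last first.
  by move: E1 E2; rewrite /dH; lra.
have [x2|/lt2 {}lt2] := eqVneq (Q (p c2)) (Q (p' c2)); last first.
  by move: E1 E2; rewrite /dH; lra.
have peq u : 0 <= u <= 1 -> Q (p u) = Q (p' u) -> p u = p' u.
  move=> u01 /(congr1 F).
  by rewrite !(QK _ (p01 _ _ _ ab u01)).1 !(QK _ (p01 _ _ _ a'b' u01)).1.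
have p1 : p c1 = p' c1 by apply: peq x1; lra.
have p2 : p c2 = p' c2 by apply: peq x2; lra.
(* Two affine functions that agree at two points are equal. *)
have GG : F b - F a = F b' - F a'.
  have c0 : c2 - c1 != 0 by lra.
  by apply: (mulfI c0); move: p1 p2; rewrite /p /p'; lra.
have Fa : F a = F a' by move: p1; rewrite /p /p' GG => /addIr.
have Fb : F b = F b' by move: GG; rewrite Fa => /addIr.
by move: neq; rewrite (slc_inj HF Fa) (slc_inj HF Fb) eqxx.
Qed.

Lemma slc_mid_lt (R : realType) (F f : R -> R) (x y : R) :
    strictly_logconcave_cdf F f -> x != y ->
  F x * F y < F (2^-1 * (x + y)) ^+ 2.
Proof.
move=> HF; have [Flt F01] := (slc_lt HF, slc_01 HF).
have F0 z : 0 < F z by have /andP[] := F01 z.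
have fraction z e : 0 < e < 1 -> exists2 a, F a = e * F z & a < z.
  move=> /andP[e0 e1]; have /andP[Fz0 Fz1] := F01 z.
  have [|a Fa] := slc_onto HF (p := e * F z); first by apply/andP; split; nra.
  by exists a => //; rewrite -Flt Fa; nra.
(* The left tail at [u] is the limit as [e] tends to 0 of the intervals
   [[a, u]] with [F a = e * F u]. *)
have step e u v : 0 < e < 1 -> u != v -> exists a b,
    [/\ F a = e * F u, F b = e * F v, a != b &
     (1 - e) * Num.sqrt (F u * F v) < F (2^-1 * (u + v)) - F (2^-1 * (a + b))].
  move=> e01 uv; have [a Fa au] := fraction u e e01.
  have [b Fb bv] := fraction v e e01; exists a, b; split => //.
    apply: contra uv => /eqP ab; apply/eqP/(slc_inj HF).
    by have e0 : e != 0; [lra | apply: (mulfI e0); rewrite -Fa -Fb ab].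
  have e1 : 0 <= 1 - e by lra.
  rewrite -[X in X * _]ger0_norm// -sqrtr_sqr -sqrtrM ?sqr_ge0//.
  rewrite [X in Num.sqrt X](_ : _ = (F u - F a) * (F v - F b)); last first.
    by rewrite Fa Fb; ring.
  by apply: (slc_interval_mid HF); rewrite // xpair_eqE negb_and uv orbT.
have weak u v : u != v -> Num.sqrt (F u * F v) <= F (2^-1 * (u + v)).
  move=> uv; rewrite leNgt; apply/negP => lt; set s := Num.sqrt _ in lt.
  have m0 := F0 (2^-1 * (u + v)); have s0 : 0 < s := lt_trans m0 lt.
  (* This [e] makes [(1 - e) * s] equal to [F] at the midpoint, so [step] would make [F] negative
     somewhere. *)
  have [|a [b [_ _ _]]] := step ((s - F (2^-1 * (u + v))) / s) u v _ uv.
    by rewrite divr_gt0 ?subr_gt0// ltr_pdivrMr// mul1r ltrBlDr ltrDl.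
  have -> : (1 - (s - F (2^-1 * (u + v))) / s) * Num.sqrt (F u * F v) =
            F (2^-1 * (u + v)) by rewrite -/s; field; rewrite gt_eqF.
  by rewrite ltrBrDr gtrDl ltNge (ltW (F0 _)).
move=> xy; have half01 : 0 < (2^-1 : R) < 1 by lra.
(* The limit keeps only a weak inequality. Strictness comes from cutting each tail at half its mass:
   the upper halves give a strict bound, the remaining tails a weak one, and the two add up. *)
have [a [b [Fa Fb /weak]]] := step 2^-1 x y half01 xy.
rewrite Fa Fb mulrACA -expr2 sqrtrM ?sqr_ge0// sqrtr_sqr ger0_norm; last lra.
move=> ab lt; have sqrtlt : Num.sqrt (F x * F y) < F (2^-1 * (x + y)) by lra.
by rewrite -[ltLHS]sqr_sqrtr ?mulr_ge0 ?ltW// ltr_pXn2r ?nnegrE ?sqrtr_ge0 ?ltW.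
Qed.

Lemma slc_interval_mid_lt (R : realType) (F f : R -> R) (a b a' b' : R) :
    strictly_logconcave_cdf F f -> a < b -> a' < b' -> (a, b) != (a', b') ->
  (F b - F a) * (F b' - F a') <
    (F (2^-1 * (b + b')) - F (2^-1 * (a + a'))) ^+ 2.
Proof.
move=> HF ab a'b' /(slc_interval_mid HF ab a'b') lt.
rewrite -[ltLHS]sqr_sqrtr; last first.
  by rewrite mulr_ge0 ?subr_ge0 ?ltW ?(slc_lt HF).
by rewrite ltr_pXn2r ?nnegrE ?sqrtr_ge0// (le_trans (sqrtr_ge0 _) (ltW lt)).
Qed.

(** * Admissible distribution functions *)

Section Admissible.
Context {R : realType} (F : cumulativeBounded (0 : R) (1 : R)).
Context (HF : admissible_cdf F).

Lemma admissible_continuous : continuous F.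
Proof.
move=> x; apply/differentiable_continuous/derivable1_diffP.
by have [/(_ 0%N isT)] := cdf_C3 HF.
Qed.

Lemma admissible_onto p : 0 < p < 1 -> exists x, F x = p.
Proof.
move=> /andP[p0 p1].
have [a Fa] : exists a, F a < p.
  exact: (filter_ex (cvgr_lt _ (cumulativeNy F) _ p0)).
have [b Fb] : exists b, p < F b.
  exact: (filter_ex (cvgr_gt _ (cumulativey F) _ p1)).
have Fc c e : {within `[c, e]%classic, continuous F}%classic.
  exact/continuous_subspaceT/admissible_continuous.
(* Both orders are treated, since monotonicity of [F] is not invoked here. *)
have [ab|/ltW ba] := leP a b.
- have [|c _ <-] := IVT ab (Fc a b) (v := p); last by exists c.
  by rewrite ge_min le_max (ltW Fa) (ltW Fb) orbT.
- have [|c _ <-] := IVT ba (Fc b a) (v := p); last by exists c.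
  by rewrite ge_min le_max (ltW Fa) (ltW Fb) orbT.
Qed.

Lemma admissible_is_derive x : is_derive x (1 : R) F (F^`()%classic x).
Proof.
apply: DeriveDef; last by rewrite derive1E.
by have [/(_ 0%N isT)] := cdf_C3 HF.
Qed.

(** The midpoint inequality is strict concavity of the log-density at [t = 1/2], exponentiated. *)
Lemma admissible_slc : strictly_logconcave_cdf F F^`()%classic.
Proof.
have f0 := pdf_gt0 HF.
split => //; [exact: cdf_in01 HF|exact: admissible_onto
  |exact: admissible_is_derive|move=> x y xy].
have half : 0 < (2^-1 : R) < 1 by lra.
have := log_pdf_strictly_concave HF xy half.
rewrite (_ : 2^-1 * x + _ = 2^-1 * (x + y)); last by field.
move=> lt; rewrite -ltr_ln ?posrE ?mulr_gt0 ?exprn_gt0//.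
by rewrite lnM ?lnXn ?posrE// mulr2n; lra.
Qed.

(** By symmetry of the density, [F y + F (- y)] has derivative zero; the constant is its limit 1 at
    infinity. *)
Lemma admissible_sym x : F (- x) = 1 - F x.
Proof.
have cst y : F y + F (- y) = F x + F (- x).
  apply: (@is_derive_0_is_cst R (fun y => F y + F (- y))) => z.
  have d1 := admissible_is_derive z; have d2 := admissible_is_derive (- z).
  have e := @is_derive1_comp _ F -%R z _ _ d2 (is_deriveN (is_derive_id z 1)).
  by apply: is_derive_eq; rewrite (pdf_sym HF); ring.
suff : F x + F (- x) = 1 by lra.
have lim : ((F z + F (- z)) @[z --> +oo] --> (1 : R))%classic.
  rewrite -[X in (_ --> X)%classic]addr0; apply: cvgD; first exact: cumulativey.
  by move/cvgNy_compNP: (cumulativeNy F).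
apply: cvg_unique lim => //.
rewrite (_ : (fun z => _) = fun=> F x + F (- x)); first exact: cvg_cst.
by apply/funext => z; exact: cst.
Qed.
End Admissible.

(** * Products of factors, spreading over a connected set, cycles *)

(** All factors being positive, one strict inequality between factors would make the products
    differ. *)
Lemma eq_prod_factor (R : realDomainType) (I : finType) (P : pred I)
    (a b : I -> R) : (forall i, P i -> 0 < a i <= b i) ->
  \prod_(i | P i) a i = \prod_(i | P i) b i -> forall i, P i -> a i = b i.
Proof.
move=> ab E i Pi; apply/eqP; have /andP[ai0 aib] := ab _ Pi.
rewrite eq_le aib /= leNgt; apply/negP => lt.
suff : \prod_(i | P i) a i < \prod_(i | P i) b i by rewrite E ltxx.
rewrite (bigD1 i)//= [ltRHS](bigD1 i)//=.
have le : \prod_(j | P j && (j != i)) a j <= \prod_(j | P j && (j != i)) b j.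
  by apply: ler_prod => j /andP[/ab/andP[/ltW -> ->]].
apply: (lt_le_trans _ (ler_wpM2l (ltW (lt_le_trans ai0 aib)) le)).
by rewrite ltr_pM2r// prodr_gt0// => j /andP[/ab/andP[]].
Qed.

Lemma prod_le_factor (R : realDomainType) (I : finType) (P : pred I)
    (a : I -> R) : (forall i, P i -> 0 <= a i <= 1) ->
  forall i, P i -> \prod_(i | P i) a i <= a i.
Proof.
move=> a01 i Pi; rewrite (bigD1 i)//=; have /andP[ai0 _] := a01 _ Pi.
by rewrite ler_piMr// prodr_ile1// => j /andP[/a01].
Qed.

(* A breadth-first search from [i0] reaches every index in at most [n] steps. *)
Lemma spread_le (R : realDomainType) (n : nat) (m : 'I_n -> R) (g : R)
    (i0 : 'I_n) : 0 <= g ->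
    (forall S : {set 'I_n}, i0 \in S -> finset.setC S != finset.set0 ->
       exists i j, [/\ i \in S, j \in finset.setC S & m j <= m i + g]) ->
  forall j, m j <= m i0 + g *+ n.
Proof.
move=> g0 next.
(* The size is capped at [n] because the search stops growing once [S] is everything. *)
have claim k : exists S : {set 'I_n}, [/\ i0 \in S, (minn k.+1 n <= #|S|)%N &
    forall i, i \in S -> m i <= m i0 + g *+ k].
  elim: k => [|k [S [i0S cS mS]]].
    exists [set i0]%SET; rewrite set11 cards1; split => // [|i].
      by rewrite geq_minl.
    by rewrite inE => /eqP ->; rewrite addr0.
  have mk i : i \in S -> m i <= m i0 + g *+ k.+1.
    move=> /mS /le_trans; apply; rewrite lerD2l mulrS lerDr//.
  have [SC|/next] := eqVneq (finset.setC S) finset.set0.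
    exists S; split => //; have -> : S = [set: 'I_n]%SET.
      by rewrite -[S]finset.setCK SC finset.setC0.
    by rewrite cardsT card_ord geq_minr.
  move=> /(_ i0S)[i [j [iS jS mij]]]; exists (j |: S)%SET; split.
  - by rewrite !inE i0S orbT.
  - move: jS; rewrite inE cardsU1 => -> /=.
    by apply: leq_trans (_ : (minn k.+1 n).+1 <= _)%N; [lia|rewrite add1n ltnS].
  - move=> l; rewrite !inE => /orP[/eqP ->|/mk//].
    rewrite (le_trans mij)// mulrSr addrA lerD2r; exact: mS.
move=> j; have [S [_ cS mS]] := claim n; apply: mS.
have /eqP -> : S == [set: 'I_n]%SET; last by rewrite inE.
by rewrite eqEcard finset.subsetT cardsT card_ord; move: cS; lia.
Qed.

(** Otherwise [v] would strictly decrease all the way around the cycle, back to its starting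
    node. *)
Lemma exists_nondecreasing_cycle_edge (R : realDomainType) (T : eqType)
    (e : rel T) (v : T -> R) : has_directed_cycle e ->
  exists x y, e x y /\ v x <= v y.
Proof.
case=> -[[]//|x c] [_ /andP[ec _]]; apply: contrapT => none.
have : path [rel y z | v z < v y] x (rcons c x).
  apply: sub_path ec => y z eyz /=; rewrite ltNge; apply/negP => vyz.
  by apply: none; exists y, z.
move=> /order_path_min => /(_ (fun b a c ab bc => lt_trans bc ab)).
by rewrite all_rcons /= ltxx.
Qed.

(** * Midpoint log-concavity of the option probabilities *)

Section Probabilities.
Context {R : realType} (F : cumulativeBounded (0 : R) (1 : R)).
Context (HF : admissible_cdf F) (n : nat).
Implicit Types (m : 'rV[R]_n) (d : R) (i j : 'I_n).
Let SF := admissible_slc HF.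

(** Written as a lower tail, option 3 is option 1 for the reversed pair. *)
Lemma option_prob3 m d i j :
  option_prob F m d i j 3 = F (- (d - (m 0 i - m 0 j))).
Proof. by rewrite (admissible_sym HF). Qed.

Lemma option_prob_sym m d i j k : (1 <= k <= 3)%N ->
  option_prob F m d i j k = option_prob F m d j i (4 - k).
Proof.
case: k => [|[|[|[|k]]]]// _.
- by rewrite !subSS subn0 option_prob3 /=; congr (F _); ring.
- rewrite !subSS subn0 /=.
  have -> : d - (m 0 j - m 0 i) = - (- d - (m 0 i - m 0 j)) by ring.
  have -> : - d - (m 0 j - m 0 i) = - (d - (m 0 i - m 0 j)) by ring.
  by rewrite !(admissible_sym HF); ring.
- by rewrite !subSS subn0 option_prob3 /=; congr (F _); ring.
Qed.

Lemma option_prob_01 m d i j k : 0 < d -> (1 <= k <= 3)%N ->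
  0 < option_prob F m d i j k <= 1.
Proof.
move=> d0; have F01 := cdf_in01 HF; case: k => [|[|[|[|k]]]]// _.
- by rewrite /=; have /andP[-> /ltW] := F01 (- d - (m 0 i - m 0 j)).
- rewrite /= subr_gt0 (slc_lt SF); apply/andP; split; first by lra.
  have /andP[? _] := F01 (- d - (m 0 i - m 0 j)).
  by have /andP[_ ?] := F01 (d - (m 0 i - m 0 j)); lra.
- by rewrite option_prob3; have /andP[-> /ltW] := F01 (- (d - (m 0 i - m 0 j))).
Qed.

Lemma option_prob2_mid_lt m m' d d' i j : 0 < d -> 0 < d' ->
    (d, m 0 i - m 0 j) != (d', m' 0 i - m' 0 j) ->
  option_prob F m d i j 2 * option_prob F m' d' i j 2 <
    option_prob F (2^-1 *: (m + m')) (2^-1 * (d + d')) i j 2 ^+ 2.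
Proof.
move=> d0 d'0; set x := m 0 i - m 0 j; set x' := m' 0 i - m' 0 j => neq.
have := @slc_interval_mid_lt R F _ (- d - x) (d - x) (- d' - x') (d' - x') SF.
rewrite /option_prob !mxE -/x -/x'.
rewrite (_ : 2^-1 * (d - x + _) =
  2^-1 * (d + d') - (2^-1 * (m 0 i + m' 0 i) - 2^-1 * (m 0 j + m' 0 j)));
  last by rewrite /x /x'; ring.
rewrite (_ : 2^-1 * (- d - x + _) =
  - (2^-1 * (d + d')) - (2^-1 * (m 0 i + m' 0 i) - 2^-1 * (m 0 j + m' 0 j)));
  last by rewrite /x /x'; ring.
apply; [by lra|by lra|].
apply: contra neq => /eqP[e1 e2]; apply/eqP; congr pair; lra.
Qed.

Lemma option_prob1_mid_lt m m' d d' i j :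
    d + (m 0 i - m 0 j) != d' + (m' 0 i - m' 0 j) ->
  option_prob F m d i j 1 * option_prob F m' d' i j 1 <
    option_prob F (2^-1 *: (m + m')) (2^-1 * (d + d')) i j 1 ^+ 2.
Proof.
move=> neq.
have := @slc_mid_lt R F _ (- d - (m 0 i - m 0 j)) (- d' - (m' 0 i - m' 0 j)) SF.
rewrite /= !mxE.
rewrite (_ : 2^-1 * (_ + (- d' - _)) = - (2^-1 * (d + d')) -
  (2^-1 * (m 0 i + m' 0 i) - 2^-1 * (m 0 j + m' 0 j))); last by ring.
by apply; apply: contra neq => /eqP e; apply/eqP; lra.
Qed.

(** In the equality case, option 2 determines both ends of its interval, hence [d] and the
    difference. Options 1 and 3 determine only [d] plus or minus the difference, so their conclusion
    about the difference is conditional on [d = d']. *)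
Lemma option_prob_mid m m' d d' i j k : 0 < d -> 0 < d' -> (1 <= k <= 3)%N ->
  let p := option_prob F m d i j k * option_prob F m' d' i j k in
  let q := option_prob F (2^-1 *: (m + m')) (2^-1 * (d + d')) i j k ^+ 2 in
  p <= q /\ (p = q -> (k = 2%N -> d = d') /\
    (d = d' -> m 0 i - m 0 j = m' 0 i - m' 0 j)).
Proof.
(* Option 3 reduces to option 1 by reversing the pair. *)
move=> d0 d'0; wlog k2 : i j k / (k <= 2)%N => [wl|] k13 p q.
  have [|k3] := leqP k 2; first by move=> k2; exact: wl.
  have {k3} k3 : k = 3%N by lia.
  have [le E] := wl j i 1%N isT isT; rewrite /p /q k3.
  rewrite !(@option_prob_sym _ _ i j 3)// !subSS subn0; split => // /E[_ {}E].
  by split => // /E; lra.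
have [k1|k2'] : k = 1%N \/ k = 2%N by lia.
- rewrite /p /q k1.
  have [E|neq] := eqVneq (d + (m 0 i - m 0 j)) (d' + (m' 0 i - m' 0 j)).
    split; last by move=> _; split => // dd'; move: E; rewrite dd' => /addrI.
    rewrite expr2 /= !mxE (_ : - d - _ = - d' - (m' 0 i - m' 0 j)); last by lra.
    by rewrite (_ : - (2^-1 * (d + d')) - _ = - d' - (m' 0 i - m' 0 j))//; lra.
  have lt := option_prob1_mid_lt neq.
  by split; [exact: ltW|move=> e; rewrite e ltxx in lt].
- rewrite /p /q k2'.
  have [[dd' E]|neq] := eqVneq (d, m 0 i - m 0 j) (d', m' 0 i - m' 0 j).
    split; last by [].
    rewrite expr2 /= !mxE dd' (_ : 2^-1 * (d' + d') = d'); last by field.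
    rewrite E (_ : 2^-1 * (m 0 i + _) - _ = m' 0 i - m' 0 j)//; lra.
  have lt := option_prob2_mid_lt d0 d'0 neq.
  by split; [exact: ltW|move=> e; rewrite e ltxx in lt].
Qed.
End Probabilities.

(** * The likelihood as a product of probabilities *)

Section Likelihood.
Context {R : realType} (F : cumulativeBounded (0 : R) (1 : R)).
Context (HF : admissible_cdf F) (n : nat).
Context (A : 'I_n -> 'I_n -> nat -> nat) (HA : comparison_data A).
Implicit Types (m : 'rV[R]_n) (d : R) (i j : 'I_n).
Local Arguments option_prob : simpl never.
Local Notation L := (likelihood F A).

Let option13 (k : 'I_3) : (1 <= k.+1 <= 3)%N := ltn_ord k.

(** A single product over triples lets the lemmas on products apply at once; ['I_3] counts from 0,
    hence the shift [t.1.+1]. *)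
Lemma likelihoodE m d : L m d =
  \prod_(t : 'I_3 * ('I_n * 'I_n) | (t.2.1 < t.2.2)%N)
    option_prob F m d t.2.1 t.2.2 t.1.+1 ^+ A t.2.1 t.2.2 t.1.+1.
Proof.
rewrite /likelihood big_add1 big_mkord.
under eq_bigr do rewrite pair_big_dep.
by rewrite pair_big_dep.
Qed.

Lemma likelihood_gt0 m d : 0 < d -> 0 < L m d.
Proof.
move=> d0; rewrite likelihoodE prodr_gt0// => -[k [i j]] _.
by rewrite exprn_gt0//; have /andP[] := option_prob_01 HF m i j d0 (option13 k).
Qed.

(* Reversing a pair turns option [k] into option [4 - k], so that a property of
   the pairs [i < j] extends to all the pairs that were compared. *)
Lemma compared_pair_ind (P : 'I_n -> 'I_n -> nat -> Prop) :
    (forall i j k, (1 <= k <= 3)%N -> P j i (4 - k)%N -> P i j k) ->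
    (forall i j k, (1 <= k <= 3)%N -> (0 < A i j k)%N -> (i < j)%N -> P i j k) ->
  forall i j k, (1 <= k <= 3)%N -> (0 < A i j k)%N -> P i j k.
Proof.
move=> Psym Plt i j k k13 Aij; have [|ji|/ord_inj ij] := ltngtP i j.
- exact: Plt.
- apply: Psym => //; apply: Plt => //; first by lia.
  by rewrite -(data_sym HA).
- by move: Aij; rewrite ij (data_diag HA).
Qed.

(** Every factor lies in (0, 1], so the product is at most any one factor, and a positive power of a
    probability is at most that probability. *)
Lemma likelihood_le_prob m d i j k : 0 < d -> (1 <= k <= 3)%N ->
  (0 < A i j k)%N -> L m d <= option_prob F m d i j k.
Proof.
move=> d0; move: i j k.
apply: (@compared_pair_ind (fun i j k => L m d <= option_prob F m d i j k)) =>
  i j k k13; first by rewrite -(option_prob_sym HF).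
move=> Aij ij; rewrite likelihoodE.
have k3 : (k.-1 < 3)%N by lia.
have k1 : k.-1.+1 = k by lia.
apply: le_trans (prod_le_factor _ (i := (Ordinal k3, (i, j))) ij) _ => /=.
  move=> [l [a b]] _ /=.
  have /andP[p0 p1] := option_prob_01 HF m a b d0 (option13 l).
  by rewrite exprn_ge0 ?exprn_ile1// ltW.
rewrite k1.
have /andP[p0 p1] := option_prob_01 HF m i j d0 k13.
exact: (ler_wiXn2l (ltW p0) p1 Aij).
Qed.

(** Factor by factor the midpoint inequality goes the other way, so the assumed inequality forces
    equality of the products, hence of every factor. *)
Lemma likelihood_mid m m' d d' : 0 < d -> 0 < d' ->
    L (2^-1 *: (m + m')) (2^-1 * (d + d')) ^+ 2 <= L m d * L m' d' ->
  forall i j k, (1 <= k <= 3)%N -> (0 < A i j k)%N ->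
    (k = 2%N -> d = d') /\ (d = d' -> m 0 i - m 0 j = m' 0 i - m' 0 j).
Proof.
move=> d0 d'0 le.
pose p (t : 'I_3 * ('I_n * 'I_n)) :=
  option_prob F m d t.2.1 t.2.2 t.1.+1 * option_prob F m' d' t.2.1 t.2.2 t.1.+1.
pose q (t : 'I_3 * ('I_n * 'I_n)) :=
  option_prob F (2^-1 *: (m + m')) (2^-1 * (d + d')) t.2.1 t.2.2 t.1.+1 ^+ 2.
pose a (t : 'I_3 * ('I_n * 'I_n)) := A t.2.1 t.2.2 t.1.+1.
have p0 t : 0 < p t.
  have /andP[? _] := option_prob_01 HF m t.2.1 t.2.2 d0 (option13 t.1).
  have /andP[? _] := option_prob_01 HF m' t.2.1 t.2.2 d'0 (option13 t.1).
  exact: mulr_gt0.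
have pq t : p t <= q t.
  by case: (option_prob_mid HF m m' t.2.1 t.2.2 d0 d'0 (option13 t.1)).
have EL : L m d * L m' d' =
    \prod_(t : 'I_3 * ('I_n * 'I_n) | (t.2.1 < t.2.2)%N) p t ^+ a t.
  by rewrite !likelihoodE -big_split; apply: eq_bigr => t _; rewrite exprMn.
have EM : L (2^-1 *: (m + m')) (2^-1 * (d + d')) ^+ 2 =
    \prod_(t : 'I_3 * ('I_n * 'I_n) | (t.2.1 < t.2.2)%N) q t ^+ a t.
  by rewrite likelihoodE -prodrXl; apply: eq_bigr => t _; rewrite /q exprAC.
have pqa (t : 'I_3 * ('I_n * 'I_n)) :
    (t.2.1 < t.2.2)%N -> 0 < p t ^+ a t <= q t ^+ a t.
  move=> _; rewrite exprn_gt0//= lerXn2r ?nnegrE ?(ltW (p0 t))//.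
  exact: le_trans (ltW (p0 t)) (pq t).
have eqpq : \prod_(t : 'I_3 * ('I_n * 'I_n) | (t.2.1 < t.2.2)%N) p t ^+ a t =
    \prod_(t : 'I_3 * ('I_n * 'I_n) | (t.2.1 < t.2.2)%N) q t ^+ a t.
  apply/eqP; rewrite eq_le -EL -EM le andbT EL EM.
  by apply: ler_prod => t /pqa/andP[/ltW -> ->].
apply: (@compared_pair_ind (fun i j k => (k = 2%N -> d = d') /\
    (d = d' -> m 0 i - m 0 j = m' 0 i - m' 0 j))) => i j k k13.
  by case=> k2 E; split => [k2'|/E]; [apply: k2; lia|lra].
move=> Aij ij.
have k3 : (k.-1 < 3)%N by lia.
have k1 : k.-1.+1 = k by lia.
have := eq_prod_factor pqa eqpq (i := (Ordinal k3, (i, j))) ij.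
rewrite /a /p /q /= k1.
have [le' E'] := option_prob_mid HF m m' i j d0 d'0 k13.
(* The exponent [A i j k] is positive, so equal powers of nonnegative numbers have equal bases. *)
move=> E; apply: E'; apply/eqP.
rewrite -(eqrXn2 Aij) ?E ?sqr_ge0//.
by have := p0 (Ordinal k3, (i, j)); rewrite /p /= k1 => /ltW.
Qed.

Lemma likelihood_continuous :
  continuous (fun q : 'rV[R]_n * R => L q.1 q.2).
Proof.
move=> q.
rewrite (_ : (fun q => _) = fun q : 'rV[R]_n * R =>
  \prod_(t : 'I_3 * ('I_n * 'I_n) | (t.2.1 < t.2.2)%N)
    option_prob F q.1 q.2 t.2.1 t.2.2 t.1.+1 ^+ A t.2.1 t.2.2 t.1.+1); last first.
  by apply/funext => x; rewrite likelihoodE.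
apply: cvg_big => [|t _]; first exact: mul_continuous.
apply: (cvg_comp (fun q : 'rV[R]_n * R =>
    option_prob F q.1 q.2 t.2.1 t.2.2 t.1.+1)
  (fun x => x ^+ _)); last exact: exprn_continuous.
have cm i : ((x : 'rV[R]_n * R).1 0 i @[x --> q] --> q.1 0 i)%classic.
  apply: (cvg_comp fst (fun m : 'rV[R]_n => m 0 i)); first exact: cvg_fst.
  exact: coord_continuous.
have cd : ((x : 'rV[R]_n * R).2 @[x --> q] --> q.2)%classic by exact: cvg_snd.
have cF (h : 'rV[R]_n * R -> R) : (h x @[x --> q] --> h q)%classic ->
    (F (h x) @[x --> q] --> F (h q))%classic.
  by move=> ch; exact: (cvg_comp h F ch (@admissible_continuous _ _ HF (h q))).
have cx i j : ((x : 'rV[R]_n * R).1 0 i - x.1 0 j @[x --> q] -->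
    q.1 0 i - q.1 0 j)%classic by exact: cvgB.
have cF1 i j : (F (- (x : 'rV[R]_n * R).2 - (x.1 0 i - x.1 0 j)) @[x --> q] -->
    F (- q.2 - (q.1 0 i - q.1 0 j)))%classic.
  by apply: (cF (fun x => - x.2 - _)); apply: cvgB => //; exact: cvgN.
have cF2 i j : (F ((x : 'rV[R]_n * R).2 - (x.1 0 i - x.1 0 j)) @[x --> q] -->
    F (q.2 - (q.1 0 i - q.1 0 j)))%classic.
  by apply: (cF (fun x => x.2 - _)); exact: cvgB.
case: t => -[[|[|[|k]]] k3] [i j]//.
- exact: (cF1 i j).
- exact: (cvgB (cF2 i j) (cF1 i j)).
- exact: (cvgB (cvg_cst (1 : R)) (cF2 i j)).
Qed.

(** * Coercivity and existence of a maximizer *)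

(** 0 is the midpoint of [y] and [- y], where the density takes equal values. *)
Lemma pdf_le_at0 y : F^`()%classic y <= F^`()%classic 0.
Proof.
have := slc_mid_le y (- y) (admissible_slc HF).
have f0 z := ltW (pdf_gt0 HF z).
by rewrite (pdf_sym HF) -expr2 subrr mulr0 ler_pXn2r ?nnegrE.
Qed.

Lemma cdf_increment_le a b : a < b -> F b - F a <= F^`()%classic 0 * (b - a).
Proof.
move=> ab; have [|c _ ->] := MVT ab (fun z _ => admissible_is_derive HF z).
  exact/continuous_subspaceT/admissible_continuous.
by rewrite ler_wpM2r ?pdf_le_at0// subr_ge0 ltW.
Qed.

Context (H1 : exists i1 j1 : 'I_n, (0 < A i1 j1 2)%N).
Context (H2 : has_directed_cycle (better_edge A)).
Context (H3 : forall S : {set 'I_n},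
  S != finset.set0 -> finset.setC S != finset.set0 ->
  (exists i2 j2 i3 j3 : 'I_n,
      [/\ i2 \in S, i3 \in S, j2 \in finset.setC S & j3 \in finset.setC S] /\
      ((0 < A i2 j2 3)%N /\ (0 < A i3 j3 1)%N)) \/
  (exists i4 j4 : 'I_n,
      [/\ i4 \in S, j4 \in finset.setC S & (0 < A i4 j4 2)%N])).

Lemma likelihood_coercive l : 0 < l -> exists r T g : R, 0 < r /\
  forall m d, 0 < d -> l <= L m d -> r <= d <= T /\
    forall i j, m 0 j <= m 0 i + g.
Proof.
move=> l0; have SF := admissible_slc HF.
have [x Fx] := filter_ex (cvgr_lt _ (cumulativeNy F) _ l0).
(* [T] is chosen so that [l <= F y] forces [- T < y]; the maximum with 1 keeps it positive. *)
pose T := Num.max 1 (- x).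
have T1 : 1 <= T by rewrite le_max lexx.
have FT : F (- T) < l.
  apply: le_lt_trans Fx; rewrite leNgt (slc_lt SF) -leNgt lerNl.
  by rewrite le_max lexx orbT.
have Fgt y : l <= F y -> - T < y by move=> /(lt_le_trans FT); rewrite (slc_lt SF).
have f0 := pdf_gt0 HF 0.
(* An equal judgment is the mass of an interval of length [2 * d], so [l <= 2 * d * f 0] with [f]
   the density. Each linking comparison costs at most [2 * T], and at most [n] of them are
   chained. *)
exists (l / (2 * F^`()%classic 0)), T, ((2 * T) *+ n).
split; first by rewrite divr_gt0 ?mulr_gt0.
move=> m d d0 lL.
have lp i j k : (1 <= k <= 3)%N -> (0 < A i j k)%N -> l <= option_prob F m d i j k.
  by move=> k13 Aij; exact: le_trans lL (likelihood_le_prob m d0 k13 Aij).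
have b3 i j : (0 < A i j 3)%N -> d - T < m 0 i - m 0 j.
  by move=> /lp-/(_ isT); rewrite (option_prob3 HF) => /Fgt; lra.
(* Some edge of the cycle has [m 0 i <= m 0 j], whereas [b3] gives [d - T < m 0 i - m 0 j]. *)
have dT : d < T.
  rewrite ltNge; apply/negP => Td.
  have [i [j [/b3]]] := exists_nondecreasing_cycle_edge (fun i => m 0 i) H2.
  by lra.
have b2 i j : (0 < A i j 2)%N -> m 0 i <= m 0 j + 2 * T.
  move=> /lp-/(_ isT); rewrite /option_prob => le.
  have /andP[? _] := cdf_in01 HF (- d - (m 0 i - m 0 j)).
  have /Fgt : l <= F (d - (m 0 i - m 0 j)) by lra.
  by lra.
split.
  rewrite (ltW dT) andbT ler_pdivrMr ?mulr_gt0//.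
  have [i [j /(lp _ _ 2%N isT) le]] := H1; apply: le_trans le _.
  apply: le_trans (cdf_increment_le _) _; first by lra.
  by rewrite le_eqVlt; apply/orP; left; apply/eqP; ring.
move=> i j; apply: (@spread_le _ _ (fun i => m 0 i)); first by lra.
move=> S iS SC; have S0 : S != finset.set0 by apply/set0Pn; exists i.
have [[i2 [j2 [i3 [j3 [[i2S i3S j2S j3S] [A2 A3]]]]]]|[i4 [j4 [i4S j4S A4]]]] :=
  H3 S0 SC.
- by exists i2, j2; split => //; have := b3 _ _ A2; lra.
- exists i4, j4; split => //; apply: b2.
  by rewrite (data_sym HA).
Qed.

Lemma argmax_exists :
  exists p, is_argmax (parameter_set R n) (fun q => L q.1 q.2) p.
Proof.
have n0 : (0 < n)%N by have [[i +] _] := H1; exact: leq_ltn_trans.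
pose o := Ordinal n0.
have l0 : 0 < L 0 1 by exact: likelihood_gt0.
have [r [T [g [r0 bound]]]] := likelihood_coercive l0.
(* The first coordinate is pinned to 0 and [d] stays above [r > 0], so the compact [K] lies inside
   the parameter set. By coercivity it contains every parameter at least as likely as the reference
   point [(0, 1)]. *)
pose box i := (if i == o then `[0, 0] else `[- g, g])%classic : set R.
pose K := ([set m : 'rV[R]_n | forall i, box i (m ord0 i)] `*` `[r, T])%classic.
have cK : compact K.
  have cbox i : compact (box i).
    by rewrite /box; case: ifP => _; exact: segment_compact.
  exact: (compact_setX (rV_compact cbox) (@segment_compact R r T)).
have KP q : parameter_set R n q -> L 0 1 <= L q.1 q.2 -> K q.
  move=> [q0 d0] /(bound _ _ d0)[rdT near]; split; last by rewrite /= in_itv.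
  move=> i /=; have := near i o; have := near o i; rewrite (q0 o)// /box.
  case: eqVneq => [->|_] /=; rewrite in_itv/=; first by rewrite (q0 o)// lexx.
  by move=> ? ?; apply/andP; split; lra.
have KD x : K x -> parameter_set R n x.
  move=> [/= mK]; rewrite in_itv/= => /andP[rd _]; split; last exact: lt_le_trans rd.
  move=> i i0; have := mK i; rewrite /box (_ : i = o); last exact: val_inj.
  by rewrite eqxx /= in_itv/= -eq_le => /eqP.
have D01 : parameter_set R n (0, 1) by split => //= i _; rewrite mxE.
have K01 : K (0, 1) := KP (0, 1) D01 (lexx _).
have [|||c] := @compact_EVT_max _ _ (fun q => L q.1 q.2) K.
- by exists (0, 1).
- exact: cK.
- exact/continuous_subspaceT/likelihood_continuous.
move=> /set_mem Kc cmax; exists c; split; first exact: KD.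
move=> y Dy; have [ly|/ltW yl] := leP (L 0 1) (L y.1 y.2).
  by apply: cmax; apply/mem_set/KP.
by apply: le_trans yl _; apply: (cmax (0, 1)); exact/mem_set.
Qed.

(** * Uniqueness of the maximizer *)

Lemma argmax_unique p q :
  is_argmax (parameter_set R n) (fun q => L q.1 q.2) p ->
  is_argmax (parameter_set R n) (fun q => L q.1 q.2) q -> p = q.
Proof.
move: p q => [m d] [m' d'] [[/= m0 d0] max] [[/= m'0 d'0] max'].
have Dmid : parameter_set R n (2^-1 *: (m + m'), 2^-1 * (d + d')).
  by split => /= [i i0|]; [rewrite !mxE m0// m'0// addr0 mulr0|lra].
have Lmid0 : 0 < L (2^-1 *: (m + m')) (2^-1 * (d + d')).
  by apply: likelihood_gt0; lra.
have edge := likelihood_mid d0 d'0.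
have {}edge : forall i j k, (1 <= k <= 3)%N -> (0 < A i j k)%N ->
    (k = 2%N -> d = d') /\ (d = d' -> m 0 i - m 0 j = m' 0 i - m' 0 j).
  (* Both maximal values dominate the value at the midpoint, which is itself a valid parameter. *)
  apply: edge; rewrite expr2.
  exact: ler_pM (ltW Lmid0) (ltW Lmid0) (max _ Dmid) (max' _ Dmid).
have dd' : d = d'.
  by have [i [j Aij]] := H1; have [/(_ erefl)] := edge i j 2 isT Aij.
congr pair => //; apply/rowP => i.
pose S := [set i | m 0 i == m' 0 i]%SET.
suff : i \in S by rewrite inE => /eqP.
apply: contraT => iS.
have n0 : (0 < n)%N by exact: leq_ltn_trans (ltn_ord i).
have S0 : S != finset.set0.
  (* Both maximizers vanish at the first object, so it belongs to [S]. *)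
  by apply/set0Pn; exists (Ordinal n0); rewrite inE m0// m'0.
have SC : finset.setC S != finset.set0 by apply/set0Pn; exists i; rewrite inE.
(* A compared pair has the same difference under both maximizers, so agreement at [a] passes to [b]:
   no comparison can leave [S]. *)
have stuck a b k : (1 <= k <= 3)%N -> (0 < A a b k)%N -> a \in S ->
    b \in finset.setC S -> False.
  move=> k13 Aab; rewrite !inE => /eqP ab /eqP; apply.
  have [_ /(_ dd')] := edge a b k k13 Aab; lra.
have [[i2 [j2 [i3 [j3 [[i2S i3S j2S j3S] [A2 A3]]]]]]|[i4 [j4 [i4S j4S A4]]]] :=
  H3 S0 SC.
- by case: (stuck i2 j2 3%N).
- by case: (stuck i4 j4 2%N).
Qed.

End Likelihood.

Theorem theorem4 (R : realType) (n : nat)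
    (F : cumulativeBounded (0 : R) (1 : R)) (HF : admissible_cdf F)
    (A : 'I_n -> 'I_n -> nat -> nat) (HA : comparison_data A)
    (H1 : exists i1 j1 : 'I_n, (0 < A i1 j1 2)%N)
    (H2 : has_directed_cycle (better_edge A))
    (H3 : forall S : {set 'I_n}, S != finset.set0 -> finset.setC S != finset.set0 ->
      (exists i2 j2 i3 j3 : 'I_n,
          [/\ i2 \in S, i3 \in S, j2 \in finset.setC S & j3 \in finset.setC S] /\
          ((0 < A i2 j2 3)%N /\ (0 < A i3 j3 1)%N)) \/
      (exists i4 j4 : 'I_n,
          [/\ i4 \in S, j4 \in finset.setC S & (0 < A i4 j4 2)%N])) :
  exists! p : 'rV[R]_n * R,
    is_argmax (parameter_set R n) (fun q => likelihood F A q.1 q.2) p.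
Proof.
have [p Hp] := argmax_exists HF HA H1 H2 H3; exists p; split => // q.
exact: (argmax_unique HF HA H1 H3 Hp).
Qed.
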